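(* Let $n\ge 3$ and let $D$ be a spanning strongly connected subdigraph of the bioriented cycle $\overleftrightarrow{C}_n$ having $k\ge 1$ asymmetric arcs. (a) $\overrightarrow{rvc}(D)=n-2$ if $k\le 2$, or $D$ is of type $D_2$, or $D$ is of type $D_4$ with $n=4$; $\overrightarrow{rvc}(D)=n-1$ if $D$ is of type $D_3$, or $D$ is of type $D_4$ with $n\ge 5$; and $\overrightarrow{rvc}(D)=n$ otherwise. (b)(i) $\overrightarrow{srvc}(D)=n-2$ if one of the following holds: $k=1$; $D$ is of type $D_1$ with $n\le 8$, or with $n\ge 9$ and $\ell(P),\ell(P')\le\lfloor n/2\rfloor+1$; $D$ is of type $D_2$ with $n\le 8$; $D$ is of type $D_4$ with $n=4$. (ii) $\overrightarrow{srvc}(D)=n-1$ if one of the following holds: $D$ is of type $D_1$ with $n\ge 9$ and $\ell(P)\in\{0,\lfloor n/2\rfloor+2\}$ or $\ell(P')\in\{0,\lfloor n/2\rfloor+2\}$; $D$ is of type $D_3$ with $5\le n\le 10$, or with $n\ge 11$ and $\ell(P),\ell(P')\le\lfloor n/2\rfloor+1$; $D$ is of type $D_4$ with $5\le n\le 8$, or with $n\ge 9$ and $\ell(P),\ell(P')\le\lfloor n/2\rfloor$. (iii) In all other cases, $\overrightarrow{srvc}(D)=n$.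
   Context: All digraphs are finite and simple. A (directed) path is a sequence of distinct vertices $x_0,\dots,x_\ell$ with each $x_{i-1}x_i$ an arc; its length is $\ell$. A digraph is strongly connected if for every ordered pair $(u,v)$ there is a $u$–$v$ path; a $u$–$v$ geodesic is a shortest $u$–$v$ path. In a vertex-coloured digraph, a path is rainbow if its internal vertices have pairwise distinct colours. A vertex-colouring of a strongly connected digraph $D$ is rainbow vertex-connected if every ordered pair $(u,v)$ is joined by a rainbow $u$–$v$ path, and strongly rainbow vertex-connected if every ordered pair is joined by a rainbow $u$–$v$ geodesic. $\overrightarrow{rvc}(D)$ (resp. $\overrightarrow{srvc}(D)$) is the minimum number of colours in a rainbow vertex-connected (resp. strongly rainbow vertex-connected) vertex-colouring of $D$. The bioriented cycle $\overleftrightarrow{C}_n$ has vertices $v_0,\dots,v_{n-1}$ (indices mod $n$) and arcs $v_iv_{i+1}$, $v_{i+1}v_i$ for all $i$. An arc $uv$ of $D$ is asymmetric if $vu\notin A(D)$. For a simple path $P$, its biorientation is a bioriented path, and the length $\ell$ of a bioriented path is the number of edges of the underlying path (number of vertices minus one; a single vertex is a trivial bioriented path of length $0$). Types: $D$ is of type $D_1$, $D_2$, $D_3$ or $D_4$ if its vertices can be labelled $v_0,\dots,v_{n-1}$ so that $D$ contains all arcs $v_iv_{i+1}$ (indices mod $n$) and the asymmetric arcs of $D$ are exactly, respectively: ($D_1$) $v_{n-1}v_0$ and $v_\ell v_{\ell+1}$ for some $0\le \ell\le n-2$, in which case $P$ is the bioriented path on $v_0,\dots,v_\ell$ and $P'$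 the bioriented path on $v_{\ell+1},\dots,v_{n-1}$ (either may be trivial); ($D_2$) $v_{n-1}v_0$, $v_0v_1$, $v_1v_2$; ($D_3$) $v_{n-1}v_0$, $v_0v_1$, $v_\ell v_{\ell+1}$ for some $2\le\ell\le n-3$, in which case $P$ is the bioriented path on $v_1,\dots,v_\ell$ and $P'$ the bioriented path on $v_{\ell+1},\dots,v_{n-1}$ (both non-trivial); ($D_4$) $v_{n-1}v_0$, $v_0v_1$, $v_\ell v_{\ell+1}$, $v_{\ell+1}v_{\ell+2}$ for some $1\le \ell\le n-3$, in which case $P$ is the bioriented path on $v_1,\dots,v_\ell$ and $P'$ the bioriented path on $v_{\ell+2},\dots,v_{n-1}$ (either may be trivial). *)

(* Defs.v *)
From mathcomp Require Import all_boot.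

Set Implicit Arguments.
Unset Strict Implicit.
Unset Printing Implicit Defensive.

(* A digraph on the vertex set T is its arc relation D : rel T.  A directed
   path u = x_0, x_1, ..., x_l = v is given by its first vertex u and the
   sequence p = [:: x_1; ...; x_l] of the remaining ones, so that its length
   is size p. *)
Section Digraph.
Variable T : finType.
Implicit Types (D : rel T) (u v : T) (p q : seq T).

Definition dipath D u v p : Prop :=
  [/\ path D u p, last u p = v & uniq (u :: p)].

Definition geodesic D u v p : Prop :=
  dipath D u v p /\ (forall q, dipath D u v q -> size p <= size q).

Definition strongly_connected D : Prop :=
  forall u v, exists p, dipath D u v p.

(* belast u p lists x_0, ..., x_{l-1}. *)
Definition internal u p : seq T := behead (belast u p).

Definition rainbow (C : eqType) (c : T -> C) u p : bool :=
  uniq (map c (internal u p)).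

Definition rainbow_vertex_connected D (C : eqType) (c : T -> C) : Prop :=
  forall u v, exists p, dipath D u v p /\ rainbow c u p.

Definition strongly_rainbow_vertex_connected D (C : eqType) (c : T -> C)
    : Prop :=
  forall u v, exists p, geodesic D u v p /\ rainbow c u p.

Definition is_minimum (S : nat -> Prop) (m : nat) : Prop :=
  S m /\ (forall j, S j -> m <= j).

(* rvc_eq D m means rvc(D) = m, and srvc_eq D m means srvc(D) = m. *)
Definition rvc_eq D (m : nat) : Prop :=
  is_minimum (fun j => exists c : T -> 'I_j, rainbow_vertex_connected D c) m.

Definition srvc_eq D (m : nat) : Prop :=
  is_minimum
    (fun j => exists c : T -> 'I_j, strongly_rainbow_vertex_connected D c) m.

Definition asym_arcs D : {set T * T} :=
  [set a | D a.1 a.2 && ~~ D a.2 a.1].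

(* v is a labelling v_0, ..., v_{n-1} of the vertices such that every
   v_i v_{i+1} is an arc of D (ordS is the successor modulo n), and the
   asymmetric arcs of D are exactly the v_i v_{i+1} with i in s. *)
Definition labelling (n : nat) D (v : 'I_n -> T) (s : seq nat) : Prop :=
  [/\ bijective v, forall i, D (v i) (v (ordS i))
    & asym_arcs D = [set (v i, v (ordS i)) | i : 'I_n & val i \in s]].

End Digraph.

Definition bicycle (n : nat) : rel 'I_n :=
  fun x y => (y == ordS x) || (x == ordS y).

(* Length of the bioriented path on v_i, v_{i+1}, ..., v_j. *)
Definition segment_length (i j : nat) : nat := j - i.

Section Types.
Variables (n : nat) (D : rel 'I_n).

(* For i = 1, 3, 4, is_Di p p' means that D is of type D_i, for some labelling
   in which the bioriented paths P and P' have lengths p and p'. *)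
Definition is_D1 (p p' : nat) : Prop :=
  exists (v : 'I_n -> 'I_n) (l : nat),
    [/\ l <= n - 2, labelling D v [:: n - 1; l],
        p = segment_length 0 l & p' = segment_length l.+1 (n - 1)].

Definition type_D2 : Prop :=
  exists v : 'I_n -> 'I_n, labelling D v [:: n - 1; 0; 1].

Definition is_D3 (p p' : nat) : Prop :=
  exists (v : 'I_n -> 'I_n) (l : nat),
    [/\ 2 <= l <= n - 3, labelling D v [:: n - 1; 0; l],
        p = segment_length 1 l & p' = segment_length l.+1 (n - 1)].

Definition is_D4 (p p' : nat) : Prop :=
  exists (v : 'I_n -> 'I_n) (l : nat),
    [/\ 1 <= l <= n - 3, labelling D v [:: n - 1; 0; l; l.+1],
        p = segment_length 1 l & p' = segment_length l.+2 (n - 1)].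

Definition type_D1 : Prop := exists p p', is_D1 p p'.
Definition type_D3 : Prop := exists p p', is_D3 p p'.
Definition type_D4 : Prop := exists p p', is_D4 p p'.

Definition rvc_case_n2 (k : nat) : Prop :=
  [\/ k <= 2, type_D2 | type_D4 /\ n = 4].

Definition rvc_case_n1 : Prop :=
  type_D3 \/ (type_D4 /\ 5 <= n).

Definition srvc_case_n2 (k : nat) : Prop :=
  [\/ k = 1,
      (type_D1 /\ n <= 8) \/
      (9 <= n /\ exists p p',
         is_D1 p p' /\ (p <= n %/ 2 + 1 /\ p' <= n %/ 2 + 1)),
      type_D2 /\ n <= 8
    | type_D4 /\ n = 4].

Definition srvc_case_n1 : Prop :=
  [\/ 9 <= n /\ (exists p p',
         is_D1 p p' /\
         ((p = 0 \/ p = n %/ 2 + 2) \/ (p' = 0 \/ p' = n %/ 2 + 2))),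
      (type_D3 /\ 5 <= n <= 10) \/
      (11 <= n /\ exists p p',
         is_D3 p p' /\ (p <= n %/ 2 + 1 /\ p' <= n %/ 2 + 1))
    | (type_D4 /\ 5 <= n <= 8) \/
      (9 <= n /\ exists p p',
         is_D4 p p' /\ (p <= n %/ 2 /\ p' <= n %/ 2))].

End Types.

(* Main.v *)
(* Idea.  Since D has an asymmetric arc, strong connectivity forces all the arcs
   of one orientation to be present, so D is the directed cycle 0, ..., n - 1
   together with the backward arcs i + 1 -> i for i outside a set s, and we may
   rotate so that n - 1 is in s.  From u to b there is always the forward path;
   the backward one exists iff b < u and no element of s lies in [b, u), and
   then its interior avoids 0 and n - 1.  Every pair joined by a forward path
   only is handled by the paths from i + 1 to i with i in s, whose interior
   misses just i and i + 1.  Hence a colouring is (strongly) rainbow iff each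
   monochromatic pair {x, y} is admissible: {x, y} meets every edge {i, i + 1}
   with i in s and, in the strong case, every interval [b, u] such that
   u - b > n / 2 and [b, u) is disjoint from s.  The minimum number of colours
   is then n if no pair is admissible, n - 1 if the admissible pairs form a
   nonempty star, and n - 2 if two of them are disjoint (or n = 3).  With at
   least three asymmetric arcs, a pair meeting all of them exists exactly for
   the types D2, D3 and D4. *)
Require Import Defs.
From mathcomp Require Import all_boot.
From mathcomp Require Import zify.

Set Implicit Arguments.
Unset Strict Implicit.
Unset Printing Implicit Defensive.

(* zify does not interpret conditionals on bool. *)
Ltac iflia := repeat match goal with
  | H : context [if ?b then _ else _] |- _ => destruct b eqn:?
  | |- context [if ?b then _ else _] => destruct b eqn:?
  end; lia.

(** * Arithmetic of rotations of the vertex set *)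

Lemma val_ordS n (x : 'I_n) : nat_of_ord (ordS x) = if x.+1 < n then x.+1 else 0.
Proof.
have xn := ltn_ord x; rewrite /=; case: ltnP => h; first by rewrite modn_small.
by rewrite (_ : x.+1 = n) ?modnn //; iflia.
Qed.

Lemma val_ord_pred n (x : 'I_n) :
  nat_of_ord (ord_pred x) = if x == 0 :> nat then n.-1 else x.-1.
Proof.
have xn := ltn_ord x; rewrite /=; case: (nat_of_ord x) xn => [|x'] xn.
  by rewrite add0n modn_small //; iflia.
by rewrite addSn /= modnDr modn_small; iflia.
Qed.

Lemma val_iter_ordS n (x : 'I_n) d : d <= n ->
  nat_of_ord (iter d (@ordS n) x) = if x + d < n then x + d else x + d - n.
Proof.
have xn := ltn_ord x; elim: d => [|d IH] dn; first by rewrite /= addn0 xn.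
by rewrite iterS val_ordS IH; iflia.
Qed.

Lemma val_iter_ord_pred n (x : 'I_n) d : d <= n ->
  nat_of_ord (iter d (@ord_pred n) x) = if d <= x then x - d else x + n - d.
Proof.
have xn := ltn_ord x; elim: d => [|d IH] dn; first by rewrite /= subn0.
have dn' : d <= n by iflia.
by rewrite iterS val_ord_pred (IH dn'); iflia.
Qed.

Lemma uniq_map_injP (T S : eqType) (f : T -> S) (s : seq T) : uniq s ->
  reflect {in s &, injective f} (uniq (map f s)).
Proof.
move=> us; apply: (iffP idP) => [|inj]; last by rewrite map_inj_in_uniq.
elim: s us => [|a s IH] //= /andP[as_ us] /andP[fas ufs] x y.
rewrite !inE => /predU1P[->|xs] /predU1P[->|ys] // e; last exact: IH.
  by case/negP: fas; rewrite e map_f.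
by case/negP: fas; rewrite -e map_f.
Qed.

(** * Paths in a directed cycle with some backward arcs *)

Section Cycle.
Variables (n : nat) (s : seq nat).
(** The backward arc from [i + 1] to [i] is indexed by its head, so it shares its index with the
    forward arc from [i] to [i + 1]. Thus [s] lists the forward arcs that lack a reverse. *)
Definition one_way_cycle : rel 'I_n :=
  fun x y => (y == ordS x) || ((x == ordS y) && ((y : nat) \notin s)).

Local Notation D := one_way_cycle.

Lemma dipath_traject (u : 'I_n) p : path D u p -> uniq (u :: p) ->
  p = traject (@ordS n) (ordS u) (size p) \/
  p = traject (@ord_pred n) (ord_pred u) (size p) /\
  all (fun y : 'I_n => (y : nat) \notin s) p.
Proof.
elim: p u => [|x p IH] u; first by left.
rewrite [path _ _ _]/= => /andP[Dux px] /andP[uxp uniqp].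
have notback y p' : p = y :: p' -> y != u.
  by move=> Ep; apply: contraNneq uxp => <-; rewrite Ep !inE eqxx orbT.
case/orP: Dux => [/eqP xE|/andP[/eqP uE xs]].
  case: (IH x px uniqp) => [Ep|[Ep _]]; first by left; rewrite {1}Ep /= xE.
  case: {IH px uniqp} p notback Ep uxp => [|y p] notback Ep uxp.
    by left; rewrite /= xE.
  by move: Ep => /= [yE _]; have := notback _ _ erefl; rewrite yE xE ordSK eqxx.
have xE : x = ord_pred u by rewrite uE ordSK.
case: (IH x px uniqp) => [Ep|[Ep ap]]; last first.
  by right; split; [rewrite {1}Ep /= xE|rewrite /= xs].
case: {IH px uniqp} p notback Ep uxp => [|y p] notback Ep uxp.
  by right; rewrite /= xs xE.
by move: Ep => /= [yE _]; have := notback _ _ erefl; rewrite yE xE ord_predK eqxx.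
Qed.

Lemma internal_traject (f : 'I_n -> 'I_n) (u x : 'I_n) d :
  reflect (exists i, 0 < i < d /\ x = iter i f u)
    (x \in internal u (traject f (f u) d)).
Proof.
case: d => [|d]; first by apply: (iffP idP) => // -[i [/andP[_]]].
have -> : internal u (traject f (f u) d.+1) = traject f (f u) d.
  by rewrite /internal trajectSr belast_rcons.
apply: (iffP trajectP) => [[i id ->]|[[|i] [// id ->]]].
  by exists i.+1; rewrite -iterSr.
by exists i; rewrite ?iterSr //; iflia.
Qed.

Lemma uniq_traject_cons (f : 'I_n -> 'I_n) u d : d < n ->
  (forall i, i <= n -> nat_of_ord (iter i f u) =
     if u + i < n then u + i else u + i - n) \/
  (forall i, i <= n -> nat_of_ord (iter i f u) =
     if i <= u then u - i else u + n - i) ->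
  uniq (u :: traject f (f u) d).
Proof.
move=> dn H; have un := ltn_ord u; rewrite -trajectS.
have -> : traject f u d.+1 = mkseq (fun i => iter i f u) d.+1.
  apply: (@eq_from_nth _ u); rewrite size_traject ?size_mkseq // => i id.
  by rewrite nth_traject // nth_mkseq.
apply/mkseq_uniqP => i j; rewrite !inE => id jd /(congr1 (@nat_of_ord n)).
by case: H => H; rewrite !H; iflia.
Qed.

Definition free b u := forall i, b <= i < u -> i \notin s.

Lemma forward_dipath (u b : 'I_n) : exists p,
  [/\ dipath D u b p, size p = (if u <= b then b - u else n - u + b) &
    forall x, (x \in internal u p) =
      if u <= b then u < x < b else (u < x) || (x < b)].
Proof.
have un := ltn_ord u; have bn := ltn_ord b.
set d := (if _ then _ else _); have dn : d < n by rewrite /d; iflia.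
exists (traject (@ordS n) (ordS u) d); split; last first.
- move=> x; have xn := ltn_ord x.
  apply/internal_traject/idP => [[i [id ->]]|].
    by rewrite val_iter_ordS; rewrite /d in dn id; iflia.
  move=> h; exists (if u < x then x - u else n - u + x); split.
    by rewrite /d; iflia.
  by apply: ord_inj; rewrite val_iter_ordS; iflia.
- by rewrite size_traject.
- split; first by elim: (d) (u) => //= m IH w; rewrite IH {1}/one_way_cycle eqxx.
    apply: ord_inj; rewrite last_traject val_iter_ordS; rewrite /d; iflia.
  by apply: uniq_traject_cons => //; left=> i; apply: val_iter_ordS.
Qed.

Lemma backward_dipath (u b : 'I_n) : b < u -> free b u -> exists p,
  [/\ dipath D u b p, size p = u - b &
    forall x, (x \in internal u p) = (b < x < u)].
Proof.
move=> bu fr; have un := ltn_ord u; have bn := ltn_ord b.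
set d := u - b; have dn : d < n by iflia.
exists (traject (@ord_pred n) (ord_pred u) d); split; last first.
- move=> x; have xn := ltn_ord x.
  apply/internal_traject/idP => [[i [id ->]]|].
    by rewrite val_iter_ord_pred; iflia.
  move=> h; exists (u - x); split; first by iflia.
  by apply: ord_inj; rewrite val_iter_ord_pred; iflia.
- by rewrite size_traject.
- split; last first.
    by apply: uniq_traject_cons => //; right=> i; apply: val_iter_ord_pred.
    by apply: ord_inj; rewrite last_traject val_iter_ord_pred; iflia.
  apply/(pathP u) => i; rewrite size_traject => id.
  have -> : nth u (u :: traject (@ord_pred n) (ord_pred u) d) i
            = iter i (@ord_pred n) u.
    by rewrite -trajectS nth_traject // ltnW.
  rewrite (set_nth_default (ord_pred u)) ?size_traject // nth_traject //.
  rewrite -iterSr iterS /one_way_cycle ord_predK eqxx -iterS.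
  rewrite fr ?orbT // val_iter_ord_pred; iflia.
Qed.

(** The arc from 0 to [n.-1] is missing because [n.-1 \in s]. Hence a backward path cannot wrap
    around, and only the path along an integer interval remains beside the forward one. *)
Lemma dipathP (u b : 'I_n) p : n.-1 \in s -> dipath D u b p ->
  (size p = (if u <= b then b - u else n - u + b) /\
    forall x, (x \in internal u p) =
      if u <= b then u < x < b else (u < x) || (x < b)) \/
  [/\ b < u, free b u, size p = u - b &
    forall x, (x \in internal u p) = (b < x < u)].
Proof.
have un := ltn_ord u; have bn := ltn_ord b.
move=> s_last [pp lp up]; have pn : size p < n.
  have : #|u :: p| <= n by rewrite -[n in _ <= n]card_ord max_card.
  by rewrite (card_uniqP up).
case: (dipath_traject pp up) => [Ep|[Ep ap]]; set d := size p in Ep pn *.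
  left; have : nat_of_ord (last u p) = b by rewrite lp.
  rewrite Ep last_traject (val_iter_ordS _ (ltnW pn)) => bE; split; first by iflia.
  move=> x; have xn := ltn_ord x.
  apply/internal_traject/idP => [[i [id ->]]|].
    by rewrite val_iter_ordS; iflia.
  move=> h; exists (if u < x then x - u else n - u + x); split; first by iflia.
  by apply: ord_inj; rewrite val_iter_ordS; iflia.
(* The trivial path is counted as forward, because the second alternative requires [b < u]. *)
have [d0|d_gt0] := posnP d.
  have bE : b = u by rewrite -lp Ep d0.
  by left; rewrite bE leqnn subnn Ep d0; split => // x; rewrite in_nil; iflia.
right; have : nat_of_ord (last u p) = b by rewrite lp.
have ns i : 0 < i <= d -> nat_of_ord (iter i (@ord_pred n) u) \notin s.
  case: i => [|i] // id; apply: (allP ap); rewrite Ep.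
  by apply/trajectP; exists i; rewrite ?iterSr.
rewrite Ep last_traject (val_iter_ord_pred _ (ltnW pn)) => bE.
(* Step [u.+1] of the backward walk would reach [n.-1], which lies in [s]. *)
have du : d <= u.
  rewrite leqNgt; apply/negP => ud; have := ns u.+1.
  by rewrite val_iter_ord_pred ?ltnn // (_ : u + n - u.+1 = n.-1) ?s_last; iflia.
split; first by iflia.
- move=> i ib; have := ns (u - i); rewrite val_iter_ord_pred; last by iflia.
  by rewrite (_ : (if _ then _ else _) = i); [apply; iflia|iflia].
- by iflia.
move=> x; have xn := ltn_ord x.
apply/internal_traject/idP => [[i [id ->]]|].
  by rewrite val_iter_ord_pred; iflia.
move=> h; exists (u - x); split; first by iflia.
by apply: ord_inj; rewrite val_iter_ord_pred; iflia.
Qed.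

End Cycle.

(** * Rainbow paths and admissible monochromatic pairs *)

Lemma uniq_internal (T : finType) (u : T) p : uniq (u :: p) -> uniq (internal u p).
Proof.
rewrite /internal lastI rcons_uniq => /andP[_].
by case: (belast u p) => //= x q /andP[].
Qed.

Lemma rainbowP (n : nat) (C : eqType) (c : 'I_n -> C) u p : uniq (u :: p) ->
  rainbow c u p <->
  (forall x y : 'I_n, x \in internal u p -> y \in internal u p ->
     x < y -> c x <> c y).
Proof.
move=> /uniq_internal up; split=> [/(uniq_map_injP _ up) inj x y xp yp xy cxy|H].
  by move: xy; rewrite (inj _ _ xp yp cxy) ltnn.
apply/(uniq_map_injP _ up) => x y xp yp cxy; apply: ord_inj.
have [xy|yx|//] := ltngtP x y; first by case: (H x y).
by case: (H y x).
Qed.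

(** Meant for [x < y < n] and [n.-1 \in s]. The first conjunct says that the pair meets the edge
    from [n.-1] to 0; the guard [i < n.-1] leaves that wrapping edge out of the second conjunct. *)
Definition covers n (s : seq nat) x y : bool :=
  ((x == 0) || (y == n.-1)) &&
  all (fun i => (i < n.-1) ==> [|| x == i, x == i.+1, y == i | y == i.+1]) s.

(* When the backward path from u to b is available but longer than half of the
   cycle, the forward one is the only geodesic and its interior is the
   complement of [b, u]. *)
Definition detours n (s : seq nat) x y : Prop :=
  forall b u, b < u < n -> free s b u -> n < 2 * (u - b) ->
    (b <= x <= u) \/ (b <= y <= u).

Section CycleColourings.
Variables (n : nat) (s : seq nat).
Hypotheses (n_ge3 : 3 <= n) (s_last : n.-1 \in s).
Variables (C : eqType) (c : 'I_n -> C).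

Local Notation D := (@one_way_cycle n s).
Local Notation compatible G :=
  (forall x y : 'I_n, x < y -> c x = c y -> G x y).

Lemma freeP b u : free s b u \/ exists2 i, i \in s & b <= i < u.
Proof.
case: (boolP (has (fun i => b <= i < u) s)) => [/hasP[i]|/hasPn H].
  by right; exists i.
by left=> i ib; apply/negP => /H; rewrite ib.
Qed.

(** The tested pairs of ends are those joined by a single path: 0 to [n.-1], and [i.+1] to [i] for
    [i] in [s]. The interior is everything but the two ends, so one of two vertices of equal colour
    must be an end. *)
Lemma rvc_covers : rainbow_vertex_connected D c -> compatible (covers n s).
Proof.
move=> H x y xy cxy; have [xn yn] := (ltn_ord x, ltn_ord y).
apply/andP; split.
  have n0 : 0 < n by lia.
  have n1 : n.-1 < n by lia.
  have [p [dp]] := H (Ordinal n0) (Ordinal n1).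
  rewrite rainbowP; last by case: dp.
  case: (dipathP s_last dp) => [[_ I]|[]] //=.
  move=> /(_ x y); rewrite !I /= => R.
  by apply/negPn/negP => N; case: R => //; lia.
apply/allP => i si; apply/implyP => ilt; have i1n : i.+1 < n by lia.
have [p [dp]] := H (Ordinal i1n) (Ordinal (ltnW i1n)).
rewrite rainbowP; last by case: dp.
case: (dipathP s_last dp) => [[_ I]|[_ /(_ i)]] /=; last first.
  by rewrite si leqnn ltnSn => /(_ isT).
move=> /(_ x y); rewrite !I /= ltnn => R.
by apply/negPn/negP => N; case: R => //; lia.
Qed.

(** If [u <= b], the interior contains neither 0 nor [n.-1]. Otherwise some [i] of [s] lies in
    [[b, u)], and the interior avoids both [i] and [i.+1]. Either way a covering pair has a vertex
    outside. *)
Lemma covers_forward (u b : 'I_n) : compatible (covers n s) ->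
  (u <= b) \/ ~ free s b u ->
  exists p, [/\ dipath D u b p, size p = (if u <= b then b - u else n - u + b)
    & rainbow c u p].
Proof.
move=> H fr; have [p [dp sz I]] := forward_dipath s u b; exists p; split=> //.
have [un bn] := (ltn_ord u, ltn_ord b).
apply/rainbowP => [|x y]; first by case: dp.
rewrite !I; have yn := ltn_ord y.
case: (leqP u b) fr => ub fr xp yp xy /(H _ _ xy)/andP[H0 Hs].
  by clear - xp yp xy H0 yn bn; lia.
have [i si ib] : exists2 i, i \in s & b <= i < u.
  by case: (freeP b u) fr => // fr [|/(_ fr)].
by have {H I sz dp H0 fr} := allP Hs i si; clear Hs; lia.
Qed.

Lemma covers_backward (u b : 'I_n) : compatible (covers n s) ->
  b < u -> free s b u ->
  exists p, [/\ dipath D u b p, size p = u - b & rainbow c u p].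
Proof.
move=> H bu fr; have [p [dp sz I]] := backward_dipath bu fr; exists p; split=> //.
have [un bn] := (ltn_ord u, ltn_ord b).
apply/rainbowP => [|x y]; first by case: dp.
by rewrite !I => xp yp xy /(H _ _ xy)/andP[H0 _]; have yn := ltn_ord y; lia.
Qed.

Lemma rvc_cycleP : rainbow_vertex_connected D c <-> compatible (covers n s).
Proof.
split=> [|H u b]; first exact: rvc_covers.
case: (leqP u b) => ub.
  by have [|p [dp _ rp]] := @covers_forward u b H; [left|exists p].
case: (freeP b u) => [fr|[i si ib]].
  by have [p [dp _ rp]] := covers_backward H ub fr; exists p.
have [|p [dp _ rp]] := @covers_forward u b H; last by exists p.
by right=> /(_ i ib); rewrite si.
Qed.

Lemma srvc_cycleP : strongly_rainbow_vertex_connected D c <->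
  compatible (fun x y => covers n s x y /\ detours n s x y).
Proof.
split=> [H x y xy cxy|H u b].
  split=> [|b u /andP[bu un] fr long].
    apply: rvc_covers xy cxy => u b.
    by have [p [[dp _] rp]] := H u b; exists p.
  have bn := ltn_trans bu un; have nub : u <= b = false by rewrite leqNgt bu.
  have [p [[dp short]]] := H (Ordinal un) (Ordinal bn).
  rewrite rainbowP; last by case: dp.
  have [q [dq sq _]] := forward_dipath s (Ordinal un) (Ordinal bn).
  have := short q dq; rewrite {}sq /= nub.
  case: (dipathP s_last dp) => [[_ I] _|[_ _ -> _]] /=; last by lia.
  move=> /(_ x y); rewrite !I /= nub => R.
  case: (boolP (b <= x <= u)) => ?; first by left.
  by right; apply/negPn/negP => N; case: R => //; lia.
have Hc : compatible (covers n s) by move=> x y xy /(H _ _ xy)[].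
have [un bn] := (ltn_ord u, ltn_ord b).
case: (leqP u b) => ub; last have nub : u <= b = false by rewrite leqNgt ub.
  have [|p [dp sp rp]] := covers_forward Hc (u := u) (b := b); first by left.
  exists p; split=> //; split=> // q /(dipathP s_last)[[]|[]].
    by rewrite sp => ->.
  by rewrite ltnNge ub.
case: (freeP b u) => [fr|[i si ib]]; last first.
  have nfr : ~ free s b u by move=> /(_ i ib); rewrite si.
  have [|p [dp sp rp]] := covers_forward Hc (u := u) (b := b); first by right.
  exists p; split=> //; split=> // q /(dipathP s_last)[[]|[]] //.
  by rewrite sp => ->.
(* On a tie both paths are geodesics. The backward one is chosen, since [covers] alone makes it
   rainbow; this is why [detours] uses a strict inequality. *)
case: (leqP (2 * (u - b)) n) => len.
  have [p [dp sp rp]] := covers_backward Hc ub fr.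
  exists p; split=> //; split=> // q /(dipathP s_last)[[]|[]].
    by rewrite sp nub => ->; lia.
  by rewrite sp => _ _ ->.
have [p [dp sp I]] := forward_dipath s u b.
exists p; split.
  split=> // q /(dipathP s_last)[[]|[]]; first by rewrite sp => ->.
  by rewrite sp nub => _ _ ->; lia.
apply/rainbowP => [|x y]; first by case: dp.
rewrite !I nub => xp yp xy /(H _ _ xy)[_ /(_ b u)].
by rewrite ub un => /(_ isT fr len); lia.
Qed.

End CycleColourings.

(** * Invariance under isomorphism *)

Section Isomorphism.
Variables (T U : finType) (e : rel T) (D : rel U) (v : T -> U).
Hypotheses (v_bij : bijective v) (v_iso : forall x y, D (v x) (v y) = e x y).

Lemma dipath_map x y p : dipath D (v x) (v y) (map v p) <-> dipath e x y p.
Proof.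
have inj := bij_inj v_bij.
rewrite /dipath -map_cons map_inj_uniq // path_map last_map.
rewrite (eq_path (e' := e)) //; split=> -[? l ?]; split=> //; first exact: inj.
by rewrite l.
Qed.

Lemma map_surj (q : seq U) : exists p, q = map v p.
Proof.
have [w vK wK] := v_bij; exists (map w q).
by rewrite -map_comp map_id_in // => x _ /=; apply: wK.
Qed.

Lemma geodesic_map x y p : geodesic D (v x) (v y) (map v p) <-> geodesic e x y p.
Proof.
rewrite /geodesic dipath_map size_map; split=> -[dp H]; split=> // q.
  by rewrite -dipath_map => /H; rewrite size_map.
by have [r ->] := map_surj q; rewrite dipath_map size_map => /H.
Qed.

Lemma rainbow_map (C : eqType) (c : U -> C) x p :
  rainbow c (v x) (map v p) = rainbow (c \o v) x p.
Proof. by rewrite /rainbow /internal belast_map behead_map -map_comp. Qed.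

Lemma rvc_map (C : eqType) (c : U -> C) :
  rainbow_vertex_connected D c <-> rainbow_vertex_connected e (c \o v).
Proof.
split=> H x y.
  have [q []] := H (v x) (v y); have [p ->] := map_surj q.
  by rewrite dipath_map rainbow_map; exists p.
have [w vK wK] := v_bij; have [p [dp rp]] := H (w x) (w y).
by exists (map v p); rewrite -[x]wK -[y]wK dipath_map rainbow_map.
Qed.

Lemma srvc_map (C : eqType) (c : U -> C) :
  strongly_rainbow_vertex_connected D c <->
  strongly_rainbow_vertex_connected e (c \o v).
Proof.
split=> H x y.
  have [q []] := H (v x) (v y); have [p ->] := map_surj q.
  by rewrite geodesic_map rainbow_map; exists p.
have [w vK wK] := v_bij; have [p [dp rp]] := H (w x) (w y).
by exists (map v p); rewrite -[x]wK -[y]wK geodesic_map rainbow_map.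
Qed.

End Isomorphism.

(** * Counting colours from the admissible pairs *)

Definition colours n (G : nat -> nat -> Prop) m : Prop :=
  exists c : 'I_n -> 'I_m, forall x y : 'I_n, x < y -> c x = c y -> G x y.

Section ColourCounts.
Variables (n : nat) (G : nat -> nat -> Prop).

(** Lower bounds: such a colouring is injective on a set that contains no admissible pair. *)
Lemma colours_le_card m (A : {set 'I_n}) :
  (forall x y : 'I_n, x \in A -> y \in A -> x < y -> ~ G x y) ->
  colours n G m -> #|A| <= m.
Proof.
move=> H [c Hc]; rewrite -[m]card_ord -(card_in_imset (f := c) (D := mem A)).
  exact: max_card.
move=> x y xA yA cxy; apply: ord_inj.
have [xy|yx|//] := ltngtP x y.
  by case: (H x y xA yA xy); apply: Hc.
by case: (H y x yA xA yx); apply: Hc.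
Qed.

(** Upper bounds: the elements of [A] serve as colours, and [f] picks the representative of each
    colour class. *)
Lemma colours_retract (A : {set 'I_n}) (f : 'I_n -> 'I_n) : 0 < n ->
  (forall x, f x \in A) ->
  (forall x y : 'I_n, x < y -> f x = f y -> G x y) -> colours n G #|A|.
Proof.
move=> n_gt0 fA H; pose x0 := Ordinal n_gt0.
exists (fun x => enum_rank_in (fA x0) (f x)) => x y xy.
by move=> /(congr1 enum_val); rewrite !enum_rankK_in //; apply: H.
Qed.

Lemma is_minimum_colours_all : (forall x y, x < y < n -> ~ G x y) ->
  is_minimum (colours n G) n.
Proof.
move=> H; split.
  by exists id => x y xy cxy; rewrite cxy ltnn in xy.
move=> m /(@colours_le_card m setT); rewrite cardsT card_ord; apply=> x y _ _ xy.
by apply: H; rewrite xy ltn_ord.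
Qed.

(** Merging [y] into [x] saves one colour. Removing the centre [z] leaves [n.-1] vertices without an
    admissible pair. *)
Lemma is_minimum_colours_star x y z :
  x < y < n -> G x y -> z < n ->
  (forall x y, x < y < n -> G x y -> x = z \/ y = z) ->
  is_minimum (colours n G) n.-1.
Proof.
move=> /andP[xy yn] Gxy zn H; have xn := ltn_trans xy yn.
have card1 k (kn : k < n) : #|[set~ Ordinal kn]| = n.-1.
  by rewrite cardsC1 card_ord.
split.
  pose X := Ordinal xn; pose Y := Ordinal yn; rewrite -(card1 y yn).
  apply: (colours_retract (f := fun t => if t == Y then X else t)).
  - by lia.
  - by move=> t; rewrite !inE -!val_eqE /= (fun_if (@nat_of_ord n)) /=; iflia.
  move=> a b ab /(congr1 (@nat_of_ord n)).
  rewrite -!val_eqE !(fun_if (@nat_of_ord n)) /= => E.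
  have [-> ->] : nat_of_ord a = x /\ nat_of_ord b = y by iflia.
  exact: Gxy.
move=> m /(@colours_le_card m [set~ Ordinal zn]); rewrite card1; apply=> a b.
rewrite !inE -!val_eqE /= => /eqP az /eqP bz ab Gab.
by case: (H a b _ Gab) => //; rewrite ab ltn_ord.
Qed.

Lemma colours_two_pairs x y x' y' :
  x < y < n -> G x y -> x' < y' < n -> G x' y' ->
  [&& x != x', x != y', y != x' & y != y'] -> colours n G n.-2.
Proof.
move=> /andP[xy yn] Gxy /andP[xy' yn'] Gxy' disj.
have [xn xn'] := (ltn_trans xy yn, ltn_trans xy' yn').
pose X := Ordinal xn; pose Y := Ordinal yn.
pose X' := Ordinal xn'; pose Y' := Ordinal yn'.
have <- : #|~: [set Y; Y']| = n.-2.
  by rewrite cardsCs setCK card_ord cards2 -val_eqE /=; lia.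
apply: (colours_retract
  (f := fun t => if t == Y then X else if t == Y' then X' else t)).
- by lia.
- by move=> t; rewrite !inE -!val_eqE /= !(fun_if (@nat_of_ord n)) /=; iflia.
move=> a b ab /(congr1 (@nat_of_ord n)).
rewrite -!val_eqE !(fun_if (@nat_of_ord n)) /= => E.
have [[-> ->]|[-> ->]] : nat_of_ord a = x /\ nat_of_ord b = y \/
  nat_of_ord a = x' /\ nat_of_ord b = y' by iflia.
- exact: Gxy.
- exact: Gxy'.
Qed.

(** Two disjoint pairs can be merged at once. No more can be saved, since the vertices other than 0
    and [n.-1] contain no admissible pair. *)
Lemma is_minimum_colours_two_pairs x y x' y' :
  (forall x y, x < y < n -> G x y -> x = 0 \/ y = n.-1) ->
  x < y < n -> G x y -> x' < y' < n -> G x' y' ->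
  [&& x != x', x != y', y != x' & y != y'] -> is_minimum (colours n G) (n - 2).
Proof.
move=> H xy Gxy xy' Gxy' disj; split.
  by rewrite subn2; apply: colours_two_pairs disj.
have n0 : 0 < n by lia.
have n1 : n.-1 < n by lia.
move=> m /(@colours_le_card m (~: [set Ordinal n0; Ordinal n1])).
rewrite cardsCs setCK card_ord cards2 -val_eqE /=.
rewrite (_ : 0 != n.-1) //; last by lia.
apply=> a b; rewrite !inE -!val_eqE /= => aA bA ab Gab; have bn := ltn_ord b.
by case: (H a b _ Gab); lia.
Qed.

(** Three vertices have no two disjoint pairs, but here all pairs are admissible and a constant
    colouring works. *)
Lemma is_minimum_colours_3 : n = 3 ->
  (forall x y, x < y < n -> G x y) -> is_minimum (colours n G) (n - 2).
Proof.
move=> n3 H; split.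
  have j : 'I_(n - 2) by rewrite n3; apply: ord0.
  by exists (fun=> j) => x y xy _; apply: H; rewrite xy ltn_ord.
move=> m [c _]; have n0 : 0 < n by rewrite n3.
by have := ltn_ord (c (Ordinal n0)); lia.
Qed.

End ColourCounts.

(** * Labellings and their normal form *)

Lemma iter_ordS_bij n a : bijective (iter a (@ordS n)).
Proof.
elim: a => [|a IH]; first by exists id.
by apply: (bij_comp _ IH); exists (@ord_pred n); [apply: ordSK|apply: ord_predK].
Qed.

Lemma path_closed (T : Type) (e : rel T) (B : pred T) x p :
  (forall y z, B y -> e y z -> B z) -> B x -> path e x p -> B (last x p).
Proof.
by move=> H; elim: p x => //= y p IH x Bx /andP[exy]; apply: IH; apply: H exy.
Qed.

Section Labellings.
Variables (n : nat) (D : rel 'I_n).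
Hypotheses (n_ge3 : 3 <= n) (D_sub : subrel D (@bicycle n)).

(** A labelling is only assumed bijective. Since [n >= 3], the labels before and after [x] give two
    distinct neighbours of [g x] in the cycle, which has no others; so [g] respects adjacency. *)
Lemma neighbours (g : 'I_n -> 'I_n) x y : bijective g ->
  (forall i, D (g i) (g (ordS i))) -> D (g x) (g y) -> y = ordS x \/ x = ordS y.
Proof.
move=> g_bij fwd Dxy; have gI := bij_inj g_bij.
have nb (a b : 'I_n) : bicycle a b -> b = ordS a \/ b = ord_pred a.
  by case/orP => /eqP ->; [left|right; rewrite ordSK].
have xE : x = ordS (ord_pred x) by rewrite ord_predK.
have SP : g (ordS x) <> g (ord_pred x).
  move=> /gI/(congr1 (@nat_of_ord n)); rewrite val_ordS val_ord_pred.
  by have := ltn_ord x; iflia.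
have back a b : D a b -> a = ordS b \/ a = ord_pred b.
  by move=> /D_sub; rewrite /bicycle orbC; apply: nb.
have Dp : g (ord_pred x) = ordS (g x) \/ g (ord_pred x) = ord_pred (g x).
  by apply: back; rewrite {2}xE; apply: fwd.
have Ds := nb _ _ (D_sub (fwd x)); have Dy := nb _ _ (D_sub Dxy).
have [/gI ->|/gI ->] : g y = g (ordS x) \/ g y = g (ord_pred x).
  case: Dy Ds Dp SP => -> [] -> [] ->; by [left|right|].
- by left.
- by right.
Qed.

(** Equality of arc sets becomes one test per index. Since all forward arcs are present, an arc
    running backward always has its reverse and is never asymmetric. *)
Lemma labellingP (g : 'I_n -> 'I_n) (s : seq nat) :
  labelling D g s <->
  [/\ bijective g, forall i, D (g i) (g (ordS i)) &
    forall i : 'I_n, ((i : nat) \in s) = ~~ D (g (ordS i)) (g i)].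
Proof.
split=> -[g_bij fwd H]; split=> //; have gI := bij_inj g_bij.
  move=> i; have := congr1 (fun A : {set _} => (g i, g (ordS i)) \in A) H.
  rewrite inE /= fwd /= => ->; apply/idP/imsetP => [si|[j]].
    by exists i; rewrite ?inE.
  by rewrite inE => sj [/gI ->].
apply/setP => -[a b]; rewrite inE /=; have [w gK wK] := g_bij.
apply/andP/imsetP => [[Dab nDba]|[i]]; last first.
  by rewrite inE H => nD [-> ->].
have [E|E] : w b = ordS (w a) \/ w a = ordS (w b).
- by apply: (neighbours g_bij fwd); rewrite !wK.
- by exists (w a); rewrite ?inE ?H -?E !wK.
- by case/negP: nDba; rewrite -[a]wK -[b]wK E.
Qed.

Lemma labelling_iso (g : 'I_n -> 'I_n) s x y : labelling D g s ->
  D (g x) (g y) = one_way_cycle s x y.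
Proof.
move=> /labellingP[g_bij fwd H]; apply/idP/idP; last first.
  by case/orP => [/eqP ->|/andP[/eqP ->]]; rewrite ?H ?negbK.
move=> Dxy; have [->|xE] := neighbours g_bij fwd Dxy.
  by rewrite /one_way_cycle eqxx.
by move: Dxy; rewrite xE => Dyx; rewrite /one_way_cycle eqxx H Dyx orbT.
Qed.

Lemma labelling_eq (g : 'I_n -> 'I_n) s t :
  (forall i, i < n -> (i \in s) = (i \in t)) ->
  labelling D g s -> labelling D g t.
Proof.
by move=> st /labellingP[? ? H]; apply/labellingP; split=> // i; rewrite -st.
Qed.

(** Used with a two-element [t], to contradict the presence of three asymmetric arcs. *)
Lemma labelling_card_le (g : 'I_n -> 'I_n) s t :
  (forall i, i < n -> i \in s -> i \in t) ->
  labelling D g s -> #|asym_arcs D| <= size t.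
Proof.
move=> st [/bij_inj gI _ ->]; rewrite card_imset => [|i j [/gI]//].
rewrite cardE -(size_map (@nat_of_ord n)); apply: uniq_leq_size.
  by rewrite map_inj_uniq ?enum_uniq //; apply: ord_inj.
by move=> i /mapP[j]; rewrite mem_enum inE => sj ->; apply: st.
Qed.

Lemma labelling_intro (g : 'I_n -> 'I_n) : bijective g ->
  (forall i, D (g i) (g (ordS i))) ->
  exists s, [/\ labelling D g s, uniq s, all (gtn n) s,
    size s = #|asym_arcs D| &
    forall i : 'I_n, ((i : nat) \in s) = ~~ D (g (ordS i)) (g i)].
Proof.
move=> g_bij fwd; pose A := [set i | ~~ D (g (ordS i)) (g i)].
have sA (i : 'I_n) :
    ((i : nat) \in map (@nat_of_ord n) (enum A)) = ~~ D (g (ordS i)) (g i).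
  by rewrite mem_map ?mem_enum ?inE //; apply: ord_inj.
have lab : labelling D g (map (@nat_of_ord n) (enum A)) by apply/labellingP.
exists (map (@nat_of_ord n) (enum A)); split=> //.
- by rewrite map_inj_uniq ?enum_uniq //; apply: ord_inj.
- by apply/allP => _ /mapP[i _ ->] /=.
case: lab => _ _ ->; rewrite card_imset => [|i j [/(bij_inj g_bij)]//].
by rewrite size_map -cardE; apply: eq_card => i; rewrite !inE sA.
Qed.

Lemma labelling_rot (g : 'I_n -> 'I_n) s a : a < n -> labelling D g s ->
  exists t, labelling D (g \o iter a (@ordS n)) t /\
    forall i, i < n ->
      (i \in t) = ((if i + a < n then i + a else i + a - n) \in s).
Proof.
move=> an /labellingP[g_bij fwd H].
have [||t [lab _ _ _ tE]] := @labelling_intro (g \o iter a (@ordS n)).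
- exact: bij_comp g_bij (iter_ordS_bij n a).
- by move=> i /=; rewrite -iterSr iterS.
exists t; split=> // i i_n; rewrite -[i]/(nat_of_ord (Ordinal i_n)) tE /=.
by rewrite -iterSr iterS -H val_iter_ordS // ltnW.
Qed.

(* Otherwise no arc leaves the cyclic interval from j + 1 to i. *)
Lemma missing_arcs_eq i j : strongly_connected D ->
  ~~ D i (ordS i) -> ~~ D (ordS j) j -> i = j.
Proof.
move=> sc nDi nDj; have [//|ij] := eqVneq i j.
pose B (x : 'I_n) := if j < i then j < x <= i else (x <= i) || (j < x).
have [i_n jn] := (ltn_ord i, ltn_ord j).
have ij' : nat_of_ord i <> j by move=> /ord_inj /eqP; apply/negP.
have [p [pp lp _]] := sc (ordS j) (ordS i).
have : B (ordS i).
  rewrite -lp; apply: path_closed pp => [x y|]; last by rewrite /B val_ordS; iflia.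
  have [xn yn] := (ltn_ord x, ltn_ord y).
  move=> Bx Dxy; case/orP: (D_sub Dxy) => /eqP E.
    have xi : nat_of_ord x <> i by move=> /ord_inj xi; rewrite E xi (negPf nDi) in Dxy.
    by move: Bx; rewrite /B E val_ordS; clear - xi ij' xn i_n jn; iflia.
  have yj : nat_of_ord y <> j by move=> /ord_inj yj; rewrite E yj (negPf nDj) in Dxy.
  by move: Bx; rewrite /B E val_ordS; clear - yj ij' yn i_n jn; iflia.
by rewrite /B val_ordS; clear - ij' i_n jn; iflia.
Qed.

Lemma labelling_exists : strongly_connected D -> 0 < #|asym_arcs D| ->
  exists (g : 'I_n -> 'I_n) s, [/\ labelling D g s, n.-1 \in s, uniq s, all (gtn n) s &
    size s = #|asym_arcs D|].
Proof.
move=> sc /card_gt0P[[x y]]; rewrite inE /= => /andP[Dxy nDyx].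
have [xn yn] := (ltn_ord x, ltn_ord y).
have n1 : n.-1 < n by lia.
suff [g [g_bij fwd nD]] : exists g, [/\ bijective g,
    forall i, D (g i) (g (ordS i)) & ~~ D (g (ordS (Ordinal n1))) (g (Ordinal n1))].
  have [s [lab us sn ss sE]] := labelling_intro g_bij fwd.
  by exists g, s; split=> //; have := sE (Ordinal n1); rewrite nD.
case/orP: (D_sub Dxy) => /eqP E.
  (* The backward arc at [x] is missing, so a missing forward arc could only be the one at [x],
     which is present. *)
  have D_fwd i : D i (ordS i).
    apply/negPn/negP => nD; rewrite E in nDyx.
    by move: (nD); rewrite (missing_arcs_eq sc nD nDyx) -E Dxy.
  exists (iter x.+1 (@ordS n)); split; first exact: iter_ordS_bij.
    by move=> i; rewrite -iterSr iterS.
  rewrite -iterSr iterS.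
  suff -> : iter x.+1 (@ordS n) (Ordinal n1) = x by rewrite -E.
  by apply: ord_inj; rewrite val_iter_ordS //=; iflia.
have D_bwd i : D (ordS i) i.
  apply/negPn/negP => nD; rewrite E in nDyx.
  by move: (nD); rewrite -(missing_arcs_eq sc nDyx nD) -E Dxy.
(* A reflection, rotated so that [n.-1] goes to [x] and 0 to [y]. *)
pose g (i : 'I_n) := iter y.+1 (@ordS n) (rev_ord i).
have gS i : g i = ordS (g (ordS i)).
  rewrite /g; suff -> : rev_ord i = ordS (rev_ord (ordS i)) by rewrite -iterSr.
  have revE (k : 'I_n) : nat_of_ord (rev_ord k) = n - k.+1 by [].
  by apply: ord_inj; have := ltn_ord i; rewrite val_ordS !revE val_ordS; iflia.
exists g; split.
- by apply: bij_comp (iter_ordS_bij n _) _; apply: inv_bij; apply: rev_ordK.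
- by move=> i; rewrite [g i]gS.
have gx : g (Ordinal n1) = x.
  by rewrite E; apply: ord_inj; rewrite /g iterS !val_ordS val_iter_ordS /=; iflia.
suff -> : g (ordS (Ordinal n1)) = y by rewrite gx.
by apply: (can_inj (@ordSK n)); rewrite -gS gx.
Qed.


(** * Classification by the asymmetric arcs *)

Lemma labelling_k1 : strongly_connected D -> #|asym_arcs D| = 1 ->
  exists g : 'I_n -> 'I_n, labelling D g [:: n - 1].
Proof.
move=> sc k1; have [|g [s [lab s1 _ _]]] := labelling_exists sc; first by rewrite k1.
rewrite k1; case: s s1 lab => [|a []] // s1 lab _; exists g.
by move: s1 lab; rewrite inE subn1 => /eqP ->.
Qed.

Lemma labelling_k2 : strongly_connected D -> #|asym_arcs D| = 2 ->
  exists (g : 'I_n -> 'I_n) l, l <= n - 2 /\ labelling D g [:: n - 1; l].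
Proof.
move=> sc k2; have [|g [s [lab s1 us sn]]] := labelling_exists sc; first by rewrite k2.
rewrite k2; case: s s1 us sn lab => [|a [|b []]] //= s1 us sn lab _.
exists g, (if a == n.-1 then b else a); split.
  by move: s1 us sn; rewrite !inE; iflia.
apply: labelling_eq lab => i i_n.
by move: s1 us sn; rewrite !inE; clear; iflia.
Qed.

Lemma labelling_triple (g : 'I_n -> 'I_n) l : 1 <= l <= n - 2 ->
  labelling D g [:: n - 1; 0; l] -> type_D2 D \/ type_D3 D.
Proof.
move=> ln lab; case: (eqVneq l 1) => [l1|l1]; first by left; exists g; rewrite l1 in lab.
case: (eqVneq l (n - 2)) => [l2|l2]; last first.
  right; exists (l - 1), (n - 1 - l.+1), g, l; split=> //; lia.
(* The indices [n - 2], [n - 1], 0 are consecutive; rotating by [n.-1] turns them into [n - 1], 0,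
   1. *)
left; have n1 : n.-1 < n by lia.
have [t [labt tE]] := labelling_rot n1 lab; exists (g \o iter n.-1 (@ordS n)).
by apply: labelling_eq labt => i i_n; rewrite tE // !inE; iflia.
Qed.

(** The pair is now [{0, w}], and both edges at 0 are asymmetric. The type depends on which of the
    edges [w.-1] and [w] at [w] are asymmetric as well. *)
Lemma covers_types_rot (g : 'I_n -> 'I_n) s w : labelling D g s ->
  n.-1 \in s -> 0 \in s -> 0 < w < n ->
  (forall i, i < n -> i \in s -> [|| i == n.-1, i == 0, i == w.-1 | i == w]) ->
  2 < #|asym_arcs D| -> [\/ type_D2 D, type_D3 D | type_D4 D].
Proof.
move=> lab s1 s0 wn sE k3.
have third : (0 < w.-1) && (w.-1 \in s) || (w < n.-1) && (w \in s).
  apply: contraTT k3 => N; rewrite -leqNgt.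
  apply: (labelling_card_le (t := [:: n.-1; 0]) _ lab) => i i_n si.
  rewrite !inE; case/or4P: (sE i i_n si) => /eqP iE; move: N; rewrite -?iE ?si;
    clear - i_n iE n_ge3 wn; lia.
have eq_s t : all (mem s) t ->
    (forall i, i \in s -> [|| i == n.-1, i == 0, i == w.-1 | i == w] -> i \in t) ->
    labelling D g t.
  move=> /allP ts st; apply: labelling_eq lab => i i_n.
  by apply/idP/idP => [si|/ts//]; apply: st => //; apply: sE.
have [sp|sp] := boolP (w.-1 \in s); have [sw|sw] := boolP (w \in s).
(* If [w] is adjacent to 0, they share an edge and only three asymmetric arcs remain; otherwise
   there are four. *)
- case: (leqP w 1) => w1.
    have [] : type_D2 D \/ type_D3 D; last by constructor 2.
      apply: (@labelling_triple g 1); first by lia.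
      apply: eq_s => [|i _]; rewrite /= ?subn1 ?s1 ?s0 ?inE; last by lia.
      by rewrite (_ : 1 = w) ?sw; lia.
    by constructor 1.
  case: (ltnP w n.-1) => wn1; last first.
    have [] : type_D2 D \/ type_D3 D; last by constructor 2.
      apply: (@labelling_triple g w.-1); first by lia.
      by apply: eq_s => [|i _]; rewrite /= ?subn1 ?s1 ?s0 ?sp ?inE //; lia.
    by constructor 1.
  constructor 3; exists (w.-1 - 1), (n - 1 - w.-1.+2), g, w.-1; split=> //; first by lia.
  rewrite prednK; last by lia.
  by apply: eq_s => [|i _]; rewrite /= ?subn1 ?s1 ?s0 ?sp ?sw ?inE //; lia.
- have [] : type_D2 D \/ type_D3 D; [|by constructor 1|by constructor 2].
  apply: (@labelling_triple g w.-1); first by move: third; rewrite (negPf sw); lia.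
  apply: eq_s => [|i si]; rewrite /= ?subn1 ?s1 ?s0 ?sp ?inE //.
  by case: (eqVneq i w) sw => [<-|]; rewrite ?si; lia.
- have [] : type_D2 D \/ type_D3 D; [|by constructor 1|by constructor 2].
  apply: (@labelling_triple g w); first by move: third; rewrite (negPf sp); lia.
  apply: eq_s => [|i si]; rewrite /= ?subn1 ?s1 ?s0 ?sw ?inE //.
  by case: (eqVneq i w.-1) sp => [<-|]; rewrite ?si; lia.
- by move: third; rewrite (negPf sp) (negPf sw) !andbF.
Qed.

(** Two vertices meet at least three asymmetric edges, so one of them has both its edges asymmetric.
    It is rotated to 0. *)
Lemma covers_types (g : 'I_n -> 'I_n) s x y : labelling D g s ->
  n.-1 \in s -> x < y < n -> covers n s x y ->
  2 < #|asym_arcs D| -> [\/ type_D2 D, type_D3 D | type_D4 D].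
Proof.
move=> lab s1 xyn /andP[cov1 /allP covs] k3.
pose pred z := if z == 0 then n.-1 else z.-1.
have cov i : i < n -> i \in s -> [|| i == x, i == pred x, i == y | i == pred y].
  move=> i_n si; have := covs i si; rewrite /pred; clear - i_n xyn cov1; iflia.
suff [z [w [zn wn zw sz [spz cov']]]] : exists z w, [/\ z < n, w < n, z != w,
    z \in s & pred z \in s /\ forall i, i < n -> i \in s ->
      [|| i == z, i == pred z, i == w | i == pred w]].
  have [t [labt tE]] := labelling_rot zn lab.
  apply: (covers_types_rot (w := if z < w then w - z else w + n - z) labt) => //.
  - rewrite tE; last by lia.
    by move: spz; congr (_ \in s); rewrite /pred; clear - zn n_ge3; iflia.
  - by rewrite tE ?add0n ?zn; last by lia.
  - by clear - zn wn zw; iflia.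
  move=> i i_n; rewrite tE // => /cov'; rewrite /pred.
  by clear - i_n zn wn zw; iflia.
case: (boolP ((x \in s) && (pred x \in s))) => [/andP[sx spx]|nx].
  by exists x, y; split=> //; lia.
case: (boolP ((y \in s) && (pred y \in s))) => [/andP[sy spy]|ny].
  exists y, x; split=> //; try lia; split=> // i i_n si.
  by have := cov i i_n si; clear; lia.
suff : #|asym_arcs D| <= 2 by lia.
(* The one edge at [z] that can be asymmetric when not both are. *)
pose pick z := if z \in s then z else pred z.
apply: (labelling_card_le (t := [:: pick x; pick y]) _ lab) => i i_n si.
have pickP z : ~~ ((z \in s) && (pred z \in s)) -> (i == z) || (i == pred z) ->
    i == pick z.
  rewrite /pick => nz /orP[] /eqP iz; first by rewrite -iz si.
  by move: nz; rewrite -iz si andbT => /negPf ->.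
by rewrite !inE; have := pickP x nx; have := pickP y ny; have := cov i i_n si;
  clear; lia.
Qed.

End Labellings.

(** * Transfer of the counts to a labelled digraph *)

Section Counts.
Variables (n : nat) (D : rel 'I_n) (g : 'I_n -> 'I_n) (s : seq nat).
Hypotheses (n_ge3 : 3 <= n) (D_sub : subrel D (@bicycle n)).
Hypotheses (lab : labelling D g s) (s_last : n.-1 \in s).

Lemma rvc_eq_labelling m :
  is_minimum (colours n (covers n s)) m -> rvc_eq D m.
Proof.
have [g_bij _ _] := lab; have iso x y : D (g x) (g y) = one_way_cycle s x y.
  exact: (labelling_iso n_ge3 D_sub).
have E j : (exists c : 'I_n -> 'I_j, rainbow_vertex_connected D c) <->
    colours n (covers n s) j.
  have [w gK wK] := g_bij; split=> -[c].
    by rewrite (rvc_map g_bij iso) (rvc_cycleP n_ge3 s_last); exists (c \o g).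
  exists (c \o w); rewrite (rvc_map g_bij iso) (rvc_cycleP n_ge3 s_last) => x y /=.
  by rewrite !gK; auto.
by case=> /E cm min; split=> // j /E; apply: min.
Qed.

Lemma srvc_eq_labelling m :
  is_minimum (colours n (fun x y => covers n s x y /\ detours n s x y)) m ->
  srvc_eq D m.
Proof.
have [g_bij _ _] := lab; have iso x y : D (g x) (g y) = one_way_cycle s x y.
  exact: (labelling_iso n_ge3 D_sub).
have E j : (exists c : 'I_n -> 'I_j, strongly_rainbow_vertex_connected D c) <->
    colours n (fun x y => covers n s x y /\ detours n s x y) j.
  have [w gK wK] := g_bij; split=> -[c].
    by rewrite (srvc_map g_bij iso) (srvc_cycleP n_ge3 s_last); exists (c \o g).
  exists (c \o w); rewrite (srvc_map g_bij iso) (srvc_cycleP n_ge3 s_last) => x y /=.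
  by rewrite !gK; auto.
by case=> /E cm min; split=> // j /E; apply: min.
Qed.

Lemma covers_n3 : n = 3 -> forall x y, x < y < n -> covers n s x y.
Proof.
move=> n3 x y xy; apply/andP; split; first by lia.
by apply/allP => i _; apply/implyP => i2; lia.
Qed.

Lemma detours_n3 : n = 3 -> forall x y, x < y < n -> detours n s x y.
Proof. by move=> n3 x y xy b u bu _ long; lia. Qed.

Lemma rvc_eq_pairs x y x' y' :
  x < y < n -> x' < y' < n -> [&& x != x', x != y', y != x' & y != y'] ->
  covers n s x y -> covers n s x' y' -> rvc_eq D (n - 2).
Proof.
move=> xy xy' disj c c'; apply: rvc_eq_labelling.
apply: is_minimum_colours_two_pairs disj => // a b _ /andP[/orP[]/eqP] ?;
  by [left|right].
Qed.

Lemma srvc_eq_pairs x y x' y' :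
  x < y < n -> x' < y' < n -> [&& x != x', x != y', y != x' & y != y'] ->
  covers n s x y /\ detours n s x y -> covers n s x' y' /\ detours n s x' y' ->
  srvc_eq D (n - 2).
Proof.
move=> xy xy' disj c c'; apply: srvc_eq_labelling.
apply: is_minimum_colours_two_pairs c' disj => // a b _ [/andP[/orP[]/eqP]] ?;
  by [left|right].
Qed.

Lemma rvc_eq_n3 : n = 3 -> rvc_eq D (n - 2).
Proof.
move=> n3; apply: rvc_eq_labelling; apply: is_minimum_colours_3 => // x y.
exact: covers_n3.
Qed.

Lemma srvc_eq_n3 : n = 3 -> srvc_eq D (n - 2).
Proof.
move=> n3; apply: srvc_eq_labelling; apply: is_minimum_colours_3 => // x y xy.
by split; [apply: covers_n3|apply: detours_n3].
Qed.

Lemma rvc_eq_star x y z : x < y < n -> covers n s x y -> z < n ->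
  (forall x y, x < y < n -> covers n s x y -> x = z \/ y = z) ->
  rvc_eq D (n - 1).
Proof.
move=> xy c zn H; rewrite subn1; apply: rvc_eq_labelling.
exact: is_minimum_colours_star xy c zn H.
Qed.

Lemma srvc_eq_star x y z : x < y < n -> covers n s x y -> detours n s x y ->
  z < n ->
  (forall x y, x < y < n -> covers n s x y -> detours n s x y -> x = z \/ y = z) ->
  srvc_eq D (n - 1).
Proof.
move=> xy c d zn H; rewrite subn1; apply: srvc_eq_labelling.
by apply: (is_minimum_colours_star xy _ zn) => // a b ab []; apply: H.
Qed.

Lemma srvc_eq_none :
  (forall x y, x < y < n -> covers n s x y -> ~ detours n s x y) -> srvc_eq D n.
Proof.
move=> H; apply: srvc_eq_labelling; apply: is_minimum_colours_all => x y xy [c].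
exact: H.
Qed.

End Counts.

(** * Values for each type *)

Lemma covers_cons n a s x y : covers n (a :: s) x y =
  ((a < n.-1) ==> [|| x == a, x == a.+1, y == a | y == a.+1]) && covers n s x y.
Proof. by rewrite /covers /= andbCA. Qed.

Lemma covers_nil n x y : covers n [::] x y = (x == 0) || (y == n.-1).
Proof. by rewrite /covers /= andbT. Qed.

Lemma free_cons a s b u : free (a :: s) b u <-> ~~ (b <= a < u) /\ free s b u.
Proof.
split=> [H|[Ha Hs] i ib].
  split; first by apply/negP => /H; rewrite inE eqxx.
  by move=> i /H; rewrite inE negb_or => /andP[].
by rewrite inE negb_or Hs // andbT; apply: contraNneq Ha => <-.
Qed.

Lemma free_nil b u : free [::] b u.
Proof. by move=> i _. Qed.

Ltac cov := rewrite !(covers_cons, covers_nil) /=; lia.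
Ltac det := move=> b u bu; rewrite !free_cons; intuition; lia.

Section Types.
Variables (n : nat) (D : rel 'I_n) (g : 'I_n -> 'I_n).
Hypotheses (n_ge3 : 3 <= n) (D_sub : subrel D (@bicycle n)).

Let last_mem s : n.-1 \in n - 1 :: s.
Proof. by rewrite inE subn1 eqxx. Qed.

Lemma srvc_k1 : labelling D g [:: n - 1] -> srvc_eq D (n - 2).
Proof.
move=> lab; case: (eqVneq n 3) => [n3|n3]; first exact: srvc_eq_n3 lab _ n3.
(* The vertices [(n./2).-1] and [uphalf n] lie in every interval of length above n/2 inside
   [[0, n - 1]]. *)
apply: (@srvc_eq_pairs _ _ _ _ n_ge3 D_sub lab _ 0 (n./2).-1 (uphalf n) n.-1) =>
  //; try lia.
- split; [cov|det].
- split; [cov|det].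
Qed.

Lemma rvc_k1 : labelling D g [:: n - 1] -> rvc_eq D (n - 2).
Proof.
move=> lab; case: (eqVneq n 3) => [n3|n3]; first exact: rvc_eq_n3 lab _ n3.
apply: (@rvc_eq_pairs _ _ _ _ n_ge3 D_sub lab _ 0 1 2 n.-1) => //; try lia; cov.
Qed.

Lemma rvc_D1 l : l <= n - 2 -> labelling D g [:: n - 1; l] -> rvc_eq D (n - 2).
Proof.
move=> ln lab; case: (eqVneq n 3) => [n3|n3]; first exact: rvc_eq_n3 lab _ n3.
(* In general each pair takes one end of each asymmetric edge. For [l = 0] or [l = n - 2] the edges
   share a vertex, which covers both and leaves its partner free. *)
pose y := if l == 0 then 2 else if l == n - 2 then n - 2 else l.+1.
pose x := if l == 0 then 1 else if l == n - 2 then 1 else l.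
apply: (@rvc_eq_pairs _ _ _ _ n_ge3 D_sub lab _ 0 y x n.-1) => //;
  rewrite /x /y ?(covers_cons, covers_nil); iflia.
Qed.


Lemma rvc_D2 : labelling D g [:: n - 1; 0; 1] -> rvc_eq D (n - 2).
Proof.
move=> lab; case: (eqVneq n 3) => [n3|n3]; first exact: rvc_eq_n3 lab _ n3.
apply: (@rvc_eq_pairs _ _ _ _ n_ge3 D_sub lab _ 0 2 1 n.-1) => //; try lia; cov.
Qed.

Lemma rvc_D3 l : 2 <= l <= n - 3 -> labelling D g [:: n - 1; 0; l] ->
  rvc_eq D (n - 1).
Proof.
move=> ln lab.
apply: (@rvc_eq_star _ _ _ _ n_ge3 D_sub lab _ 0 l 0) => //; try lia; first by cov.
by move=> x y xy; rewrite !(covers_cons, covers_nil); lia.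
Qed.

(** For [n >= 5] the only cover is [{0, l.+1}], the two vertices where asymmetric arcs are
    consecutive. For [n = 4] all arcs are asymmetric and both diagonals cover. *)
Lemma rvc_D4 l : 1 <= l <= n - 3 -> labelling D g [:: n - 1; 0; l; l.+1] ->
  5 <= n -> rvc_eq D (n - 1).
Proof.
move=> ln lab n5.
apply: (@rvc_eq_star _ _ _ _ n_ge3 D_sub lab _ 0 l.+1 0) => //; try lia; first by cov.
by move=> x y xy; rewrite !(covers_cons, covers_nil); lia.
Qed.

Lemma rvc_D4_n4 l : 1 <= l <= n - 3 -> labelling D g [:: n - 1; 0; l; l.+1] ->
  n = 4 -> rvc_eq D (n - 2).
Proof.
move=> ln lab n4.
apply: (@rvc_eq_pairs _ _ _ _ n_ge3 D_sub lab _ 0 2 1 n.-1) => //; try lia; cov.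
Qed.

(** For [0 < l < n - 2], each chosen pair contains one end of P and one end of P', leaving intervals
    one shorter than these paths: hence the bound n/2 + 1. The bound [n <= 8] means that n - 4 is at
    most n/2. *)
Lemma srvc_D1 l : l <= n - 2 -> labelling D g [:: n - 1; l] ->
  n <= 8 \/ (l <= n %/ 2 + 1 /\ n - 1 - l.+1 <= n %/ 2 + 1) ->
  srvc_eq D (n - 2).
Proof.
move=> ln lab short; case: (eqVneq n 3) => [n3|n3]; first exact: srvc_eq_n3 lab _ n3.
pose y := if l == 0 then n./2 else if l == n - 2 then n - 2 else l.+1.
pose x := if l == 0 then 1 else if l == n - 2 then (n./2).-1 else l.
apply: (@srvc_eq_pairs _ _ _ _ n_ge3 D_sub lab _ 0 y x n.-1) => //;
  rewrite /x /y; try iflia.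
- split; first by rewrite !(covers_cons, covers_nil); iflia.
  by move=> b u bu; rewrite !free_cons => -[? [? _]]; iflia.
- split; first by rewrite !(covers_cons, covers_nil); iflia.
  by move=> b u bu; rewrite !free_cons => -[? [? _]]; iflia.
Qed.

(** Exhibits [[b, u]] as a long interval free of [s], which the pair has to meet. *)
Ltac detour d b u := let h := fresh in
  have h := d b u ltac:(lia)
    ltac:(rewrite !free_cons; do ?split; try exact: free_nil; lia)
    ltac:(lia).

(** In each case the long interval excludes all covering pairs that avoid the centre. Its length is
    n - 4, above n/2 as [9 <= n], when P or P' is trivial, and [n %/ 2 + 1] otherwise. *)
Lemma srvc_D1_star l : l <= n - 2 -> labelling D g [:: n - 1; l] -> 9 <= n ->
  (l = 0 \/ l = n %/ 2 + 2) \/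
    (n - 1 - l.+1 = 0 \/ n - 1 - l.+1 = n %/ 2 + 2) ->
  srvc_eq D (n - 1).
Proof.
move=> ln lab n9 [[l0|l0]|[l0|l0]].
- apply: (@srvc_eq_star _ _ _ _ n_ge3 D_sub lab _ 0 n./2 0) => //; try lia.
  + by cov.
  + by det.
  move=> x y xy; rewrite !(covers_cons, covers_nil) => c d.
  by detour d 2 (n - 2); lia.
- apply: (@srvc_eq_star _ _ _ _ n_ge3 D_sub lab _ 0 l 0) => //; try lia.
  + by cov.
  + by det.
  move=> x y xy; rewrite !(covers_cons, covers_nil) => c d.
  by detour d 0 l.-1; lia.
- apply: (@srvc_eq_star _ _ _ _ n_ge3 D_sub lab _ n./2 n.-1 n.-1) => //; try lia.
  + by cov.
  + by det.
  move=> x y xy; rewrite !(covers_cons, covers_nil) => c d.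
  by detour d 1 (n - 3); lia.
- apply: (@srvc_eq_star _ _ _ _ n_ge3 D_sub lab _ l.+1 n.-1 n.-1) => //; try lia.
  + by cov.
  + by det.
  move=> x y xy; rewrite !(covers_cons, covers_nil) => c d.
  by detour d l.+2 n.-1; lia.
Qed.

(** A covering pair uses only 0, [n.-1], [l] and [l.+1]. Removing both ends of the long path leaves
    an interval that it misses and that still exceeds n/2. *)
Lemma srvc_D1_none l : 0 < l < n - 2 -> labelling D g [:: n - 1; l] ->
  n %/ 2 + 2 < l \/ n %/ 2 + 2 < n - 1 - l.+1 -> srvc_eq D n.
Proof.
move=> ln lab long; apply: (@srvc_eq_none _ _ _ _ n_ge3 D_sub lab) => // x y xy.
rewrite !(covers_cons, covers_nil) => c d; case: long => long.
  by detour d 1 l.-1; lia.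
by detour d l.+2 (n - 2); lia.
Qed.

Lemma srvc_D2 : labelling D g [:: n - 1; 0; 1] -> n <= 8 -> srvc_eq D (n - 2).
Proof.
move=> lab n8; case: (eqVneq n 3) => [n3|n3]; first exact: srvc_eq_n3 lab _ n3.
apply: (@srvc_eq_pairs _ _ _ _ n_ge3 D_sub lab _ 0 2 1 n.-1) => //; try lia.
- split; [cov|det].
- split; [cov|det].
Qed.

Lemma srvc_D2_none : labelling D g [:: n - 1; 0; 1] -> 9 <= n -> srvc_eq D n.
Proof.
move=> lab n9; apply: (@srvc_eq_none _ _ _ _ n_ge3 D_sub lab) => // x y xy.
rewrite !(covers_cons, covers_nil) => c d.
(* The covers are [{0, 1}], [{0, 2}] and [{1, n.-1}]; each misses one of these intervals of length n
   - 4. *)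
by detour d 3 n.-1; detour d 2 (n - 2); lia.
Qed.

Lemma srvc_D3 l : 2 <= l <= n - 3 -> labelling D g [:: n - 1; 0; l] ->
  n <= 10 \/ (l - 1 <= n %/ 2 + 1 /\ n - 1 - l.+1 <= n %/ 2 + 1) ->
  srvc_eq D (n - 1).
Proof.
move=> ln lab short.
(* The covers are [{0, l}] and [{0, l.+1}]. P and P' have total length n - 3, so at most one exceeds
   n/2; the partner of 0 is an end of that one, cutting it by one. *)
apply: (@srvc_eq_star _ _ _ _ n_ge3 D_sub lab _ 0
  (if n - 1 - l.+1 <= n %/ 2 then l else l.+1) 0) => //; try iflia.
- by rewrite !(covers_cons, covers_nil); iflia.
- by move=> b u bu; rewrite !free_cons => -[? [? [? _]]]; iflia.
by move=> x y xy; rewrite !(covers_cons, covers_nil); lia.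
Qed.

Lemma srvc_D3_none l : 2 <= l <= n - 3 -> labelling D g [:: n - 1; 0; l] ->
  n %/ 2 + 1 < l - 1 \/ n %/ 2 + 1 < n - 1 - l.+1 -> srvc_eq D n.
Proof.
move=> ln lab long; apply: (@srvc_eq_none _ _ _ _ n_ge3 D_sub lab) => // x y xy.
rewrite !(covers_cons, covers_nil) => c d; case: long => long.
  by detour d 1 l.-1; lia.
by detour d l.+2 n.-1; lia.
Qed.

(** The cover [{0, l.+1}] meets neither P nor P', so their full lengths must be at most n/2. *)
Lemma srvc_D4 l : 1 <= l <= n - 3 -> labelling D g [:: n - 1; 0; l; l.+1] ->
  5 <= n <= 8 \/ (9 <= n /\ l - 1 <= n %/ 2 /\ n - 1 - l.+2 <= n %/ 2) ->
  srvc_eq D (n - 1).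
Proof.
move=> ln lab short.
apply: (@srvc_eq_star _ _ _ _ n_ge3 D_sub lab _ 0 l.+1 0) => //; try lia.
- by cov.
- by det.
by move=> x y xy; rewrite !(covers_cons, covers_nil); lia.
Qed.

Lemma srvc_D4_n4 l : 1 <= l <= n - 3 -> labelling D g [:: n - 1; 0; l; l.+1] ->
  n = 4 -> srvc_eq D (n - 2).
Proof.
move=> ln lab n4.
apply: (@srvc_eq_pairs _ _ _ _ n_ge3 D_sub lab _ 0 2 1 n.-1) => //; try lia.
- split; [cov|det].
- split; [cov|det].
Qed.

Lemma srvc_D4_none l : 1 <= l <= n - 3 -> labelling D g [:: n - 1; 0; l; l.+1] ->
  5 <= n -> n %/ 2 < l - 1 \/ n %/ 2 < n - 1 - l.+2 -> srvc_eq D n.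
Proof.
move=> ln lab n5 long; apply: (@srvc_eq_none _ _ _ _ n_ge3 D_sub lab) => // x y xy.
rewrite !(covers_cons, covers_nil) => c d; case: long => long.
  by detour d 1 l; lia.
by detour d l.+2 n.-1; lia.
Qed.

End Types.

(** * The case analysis *)

Lemma covers_pairP n s :
  (exists x y, x < y < n /\ covers n s x y) \/
  (forall x y, x < y < n -> ~ covers n s x y).
Proof.
case: (boolP [exists x : 'I_n, [exists y : 'I_n, (x < y) && covers n s x y]]).
  move=> /existsP[x /existsP[y /andP[xy c]]].
  by left; exists x, y; rewrite xy ltn_ord.
move=> /existsPn N; right=> x y /andP[xy yn].
have /existsPn/(_ (Ordinal yn)) := N (Ordinal (ltn_trans xy yn)).
by rewrite /= xy => /negP.
Qed.

Theorem theorem10 (n k : nat) (D : rel 'I_n)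
    (n_ge3 : 3 <= n)
    (D_sub : subrel D (@bicycle n))
    (D_sc : strongly_connected D)
    (D_k : #|asym_arcs D| = k)
    (k_ge1 : 1 <= k) :
  ((rvc_case_n2 D k -> rvc_eq D (n - 2)) /\
   (rvc_case_n1 D -> rvc_eq D (n - 1)) /\
   (~ rvc_case_n2 D k -> ~ rvc_case_n1 D -> rvc_eq D n)) /\
  ((srvc_case_n2 D k -> srvc_eq D (n - 2)) /\
   (srvc_case_n1 D -> srvc_eq D (n - 1)) /\
   (~ srvc_case_n2 D k -> ~ srvc_case_n1 D -> srvc_eq D n)).
Proof.
have k12 : k <= 2 -> (exists g : 'I_n -> 'I_n, labelling D g [:: n - 1]) \/
    exists (g : 'I_n -> 'I_n) l, l <= n - 2 /\ labelling D g [:: n - 1; l].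
  move=> k2; case: (ltnP k 2) => k1.
    by left; apply: labelling_k1 => //; lia.
  by right; apply: labelling_k2 => //; lia.
have [|g [s [lab s1 _ _ _]]] := labelling_exists n_ge3 D_sub D_sc; first by rewrite D_k.
split; split.
- case=> [/k12[[h hlab]|[h [l [ln hlab]]]]|[h hlab]|[[_ [_ [h [l [ln hlab _ _]]]]] n4]].
  + exact: rvc_k1 hlab.
  + exact: rvc_D1 ln hlab.
  + exact: rvc_D2 hlab.
  + exact: rvc_D4_n4 ln hlab n4.
- split.
    case=> [[_ [_ [h [l [ln hlab _ _]]]]]|[[_ [_ [h [l [ln hlab _ _]]]]] n5]].
      exact: rvc_D3 ln hlab.
    exact: rvc_D4 ln hlab n5.
  move=> N2 N1.
  have k3 : 2 < #|asym_arcs D|.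
    by rewrite D_k ltnNge; apply/negP => k2; apply: N2; constructor 1.
  apply: (rvc_eq_labelling n_ge3 D_sub lab s1).
  apply: is_minimum_colours_all => x y xy c.
  case: (covers_types n_ge3 D_sub lab s1 xy c k3) => [D2|D3|D4].
  + by apply: N2; constructor 2.
  + by apply: N1; left.
  have [_ [_ [_ [l [ln _ _ _]]]]] := D4.
  (* The range of [l] already gives [n >= 4]. *)
  have [n4|n4] := eqVneq n 4; first by apply: N2; constructor 3.
  by apply: N1; right; split=> //; lia.
- case=> [k1|[[[p [p' [h [l [ln hlab pE pE']]]]] n8]
             |[n9 [p [p' [[h [l [ln hlab pE pE']]] short]]]]]
         |[[h hlab] n8]|[[_ [_ [h [l [ln hlab _ _]]]]] n4]].
  + have [|h hlab] := labelling_k1 n_ge3 D_sub D_sc; first by rewrite D_k.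
    exact: srvc_k1 hlab.
  + by apply: srvc_D1 ln hlab _ => //; left.
  + by apply: srvc_D1 ln hlab _ => //; right; rewrite /segment_length in pE pE'; lia.
  + exact: srvc_D2 hlab n8.
  + exact: srvc_D4_n4 ln hlab n4.
split.
  case=> [[n9 [p [p' [[h [l [ln hlab pE pE']]] pp]]]]
         |[[[p [p' [h [l [ln hlab pE pE']]]]] n10]
          |[n11 [p [p' [[h [l [ln hlab pE pE']]] short]]]]]
         |[[[p [p' [h [l [ln hlab pE pE']]]]] n58]
          |[n9 [p [p' [[h [l [ln hlab pE pE']]] short]]]]]];
    rewrite /segment_length ?subn0 in pE pE'; subst p p'.
  + exact: srvc_D1_star ln hlab n9 pp.
  + by apply: srvc_D3 ln hlab _ => //; left; case/andP: n10.
  + by apply: srvc_D3 ln hlab _ => //; right.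
  + by apply: srvc_D4 ln hlab _ => //; left.
  + by apply: srvc_D4 ln hlab _ => //; right.
move=> N2 N1.
have k2 : 1 < k.
  rewrite ltnNge; apply/negP => k1; apply: N2; constructor 1.
  by apply/eqP; rewrite eqn_leq k1.
case: (ltnP 2 k) => k3; last first.
  have [|h [l [ln hlab]]] := labelling_k2 n_ge3 D_sub D_sc; first by lia.
  have D1 : is_D1 D l (n - 1 - l.+1).
    by exists h, l; split=> //; rewrite /segment_length subn0.
  have n9 : 8 < n.
    rewrite ltnNge; apply/negP => n8; apply: N2; constructor 2; left.
    by split=> //; exists l, (n - 1 - l.+1).
  have short : ~ (l <= n %/ 2 + 1 /\ n - 1 - l.+1 <= n %/ 2 + 1).
    by move=> short; apply: N2; constructor 2; right; split=> //;
      exists l, (n - 1 - l.+1).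
  have star : ~ ((l = 0 \/ l = n %/ 2 + 2) \/
      (n - 1 - l.+1 = 0 \/ n - 1 - l.+1 = n %/ 2 + 2)).
    by move=> star; apply: N1; constructor 1; split=> //;
      exists l, (n - 1 - l.+1).
  (* Some length exceeds n/2 + 1 and none equals n/2 + 2 or 0, so one exceeds n/2 + 2 and both paths
     are non-trivial. *)
  by apply: (srvc_D1_none n_ge3 D_sub (l := l) _ hlab); lia.
have [[x [y [xy c]]]|none] := covers_pairP n s; last first.
  by apply: (srvc_eq_none n_ge3 D_sub lab s1) => x y xy c; case: (none x y xy).
rewrite -D_k in k3.
have [[h hlab]|[p [p' D3]]|[p [p' D4]]] := covers_types n_ge3 D_sub lab s1 xy c k3.
- apply: (srvc_D2_none n_ge3 D_sub hlab); rewrite ltnNge; apply/negP => n8.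
  by apply: N2; constructor 3; split; first by exists h.
- have [h [l [ln hlab pE pE']]] := D3; rewrite /segment_length in pE pE'.
  have n11 : 10 < n.
    rewrite ltnNge; apply/negP => n10; apply: N1; constructor 2; left.
    by split; [exists p, p'|lia].
  have short : ~ (p <= n %/ 2 + 1 /\ p' <= n %/ 2 + 1).
    by move=> short; apply: N1; constructor 2; right; split=> //; exists p, p'.
  by apply: srvc_D3_none ln hlab _ => //; lia.
have [h [l [ln hlab pE pE']]] := D4; rewrite /segment_length in pE pE'.
have n9 : 8 < n.
  rewrite ltnNge; apply/negP => n8; have [n4|n4] := eqVneq n 4.
    by apply: N2; constructor 4; split=> //; exists p, p'.
  apply: N1; constructor 3; left.
  by split; [exists p, p'|lia].
have short : ~ (p <= n %/ 2 /\ p' <= n %/ 2).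
  by move=> short; apply: N1; constructor 3; right; split=> //; exists p, p'.
by apply: srvc_D4_none ln hlab _ _ => //; lia.
Qed.
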